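(* Let $0<p<1$, let $A\in\mathbb{C}^{n\times n}$, let $Q\in\mathbb{C}^{n\times n}$ be Hermitian positive definite, and let $X$ be the unique Hermitian positive definite solution of $X-A^*X^{-p}A=Q$. Let $\widetilde{X}\in\mathbb{C}^{n\times n}$ be Hermitian positive definite (an approximation to $X$), and put $R(\widetilde{X})=Q+A^*\widetilde{X}^{-p}A-\widetilde{X}$. If $\|\widetilde{X}^{-\frac{p}{2}}A\|^{2}\,\|\widetilde{X}^{-1}\|<1$ and $$\|R(\widetilde{X})\|\leq\frac{\theta_{1}}{2}\min\left\{1,\frac{\theta_{1}}{2\lambda_{\min}(\widetilde{X})}\right\},\quad\text{where}\quad \theta_{1}=\left(1-\|\widetilde{X}^{-\frac{p}{2}}A\|^{2}\,\|\widetilde{X}^{-1}\|\right)\lambda_{\min}(\widetilde{X})+\|R(\widetilde{X})\|>0,$$ then $$\|\widetilde{X}-X\|\leq\theta\,\|R(\widetilde{X})\|,\quad\text{where}\quad \theta=\frac{2\lambda_{\min}(\widetilde{X})}{\theta_{1}+\sqrt{\theta_{1}^{2}-4\lambda_{\min}(\widetilde{X})\,\|R(\widetilde{X})\|}}.$$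
   Context: $\|\cdot\|$ is the spectral norm, $\lambda_{\min}(M)$ the smallest eigenvalue of a Hermitian matrix $M$, $A^*$ the conjugate transpose; real powers of positive definite matrices are defined by the spectral functional calculus. For $0<p<1$ and Hermitian positive definite $Q$, the equation $X-A^*X^{-p}A=Q$ always has a unique Hermitian positive definite solution (known fact). *)

(* Defs.v *)
From mathcomp Require Import all_boot all_order all_algebra.
From mathcomp Require Import complex.
From mathcomp Require Import all_classical all_reals exp.

Set Implicit Arguments.
Unset Strict Implicit.
Unset Printing Implicit Defensive.

Import Order.TTheory GRing.Theory Num.Theory.
Local Open Scope ring_scope.
Local Open Scope classical_set_scope.
Local Open Scope complex_scope.
Local Open Scope sesquilinear_scope.

(* On [R[i]] the order of MathComp is partial: [0 < z] says that [z] is real and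
   positive. *)
Definition posdefmx (R : realType) (n : nat) (M : 'M[R[i]]_n) : Prop :=
  M \is hermsymmx /\
  forall x : 'cV[R[i]]_n, x != 0 -> 0 < (x ^t* *m M *m x) 0 0.

Definition norm2 (R : realType) (n : nat) (x : 'cV[R[i]]_n) : R :=
  Num.sqrt (\sum_(i < n) (complex.Re (x i 0) ^+ 2 + complex.Im (x i 0) ^+ 2)).

(* The operator norm induced by the Euclidean norm; the norm [`|M|] that
   MathComp-Analysis puts on matrices is the largest modulus of an entry. *)
Definition specnorm (R : realType) (m n : nat) (M : 'M[R[i]]_(m, n)) : R :=
  sup [set norm2 (M *m x) | x in [set x : 'cV[R[i]]_n | norm2 x = 1]].

(* A Hermitian matrix of positive size has finitely many eigenvalues, at least
   one, and all of them are real, so that this infimum is attained. *)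
Definition lambda_min (R : realType) (n : nat) (M : 'M[R[i]]_n) : R :=
  inf [set a : R | eigenvalue M a%:C].

(* For [M] Hermitian positive definite,
   [M = invmx P *m diag_mx d *m P] with [P = spectralmx M] unitary and
   [d = spectral_diag M] with real positive entries ([orthomx_spectralP]). *)
Definition mxpowR (R : realType) (n : nat) (M : 'M[R[i]]_n) (a : R) :
    'M[R[i]]_n :=
  invmx (spectralmx M)
    *m diag_mx (map_mx (fun z : R[i] => (complex.Re z `^ a)%:C) (spectral_diag M))
    *m spectralmx M.

(* Main.v *)
(** The residual condition makes [delta = theta * |res|] a root of
    [delta = |res| + c l delta / (l - delta)], [l] being the smallest eigenvalue
    of [Xt]. By the Loewner-Heinz inequality the map
    [Y |-> Q + A^* Y^(-p) A] then sends the ball of radius [delta] around [Xt]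
    into itself, and it contracts Thompson's metric on positive definite matrices
    by the factor [p]. Hence its iterates from [Xt] converge to [X] while staying
    in the ball, which replaces Brouwer's theorem. All inequalities between
    matrices are inequalities of quadratic forms [rdot x (M *m x)]. *)

Require Import Defs.
From HB Require Import structures.
From mathcomp Require Import all_boot all_order all_algebra.
From mathcomp Require Import complex.
From mathcomp Require Import all_classical all_reals exp.
From mathcomp Require Import topology normedtype sequences ring lra.

Set Implicit Arguments.
Unset Strict Implicit.
Unset Printing Implicit Defensive.

Import Order.TTheory GRing.Theory Num.Theory numFieldNormedType.Exports.
Local Open Scope ring_scope.
Local Open Scope sesquilinear_scope.
Local Open Scope complex_scope.

(** * The real inner product on complex column vectors *)

Section RealDotProduct.
Context {R : realType}.
Local Notation C := R[i].

(* The matrix product below a [_ ^t*] is elaborated along another path of the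
   algebraic hierarchy than the one of matrices over [R[i]]; the explicit type of
   [adjmx] keeps all products on the latter, which makes unification tractable. *)
Definition adjmx m n (M : 'M[C]_(m, n)) : 'M[C]_(n, m) := M ^t*.

Lemma adjmxK m n (M : 'M[C]_(m, n)) : adjmx (adjmx M) = M.
Proof. exact: trmxCK. Qed.

Lemma adjmxM m n k (M : 'M[C]_(m, n)) (N : 'M[C]_(n, k)) :
  adjmx (M *m N) = adjmx N *m adjmx M.
Proof. by rewrite /adjmx trmx_mul map_mxM. Qed.

Lemma adjmx0 m n : adjmx (0 : 'M[C]_(m, n)) = 0.
Proof. by rewrite /adjmx trmx0 map_mx0. Qed.

(** The real part makes this the Euclidean inner product of the underlying real space of dimension
    [2 m]. Quadratic forms of Hermitian matrices are real, so nothing is lost on them and their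
    inequalities live in [R]. *)
Definition rdot m (x y : 'cV[C]_m) : R := complex.Re ((adjmx x *m y) 0 0).

Lemma ReD (a b : C) : complex.Re (a + b) = complex.Re a + complex.Re b.
Proof. by case: a; case: b. Qed.

Lemma ReN (a : C) : complex.Re (- a) = - complex.Re a.
Proof. by case: a. Qed.

Lemma rdotE m (x y : 'cV[C]_m) : rdot x y = \sum_i
  (complex.Re (x i 0) * complex.Re (y i 0) + complex.Im (x i 0) * complex.Im (y i 0)).
Proof.
rewrite /rdot mxE (big_morph (@complex.Re R) ReD (erefl : complex.Re 0 = 0)).
apply: eq_bigr => i _; rewrite !mxE.
by case: (x i 0) => a b; case: (y i 0) => c d /=; rewrite mulNr opprK.
Qed.

Lemma rdotC m (x y : 'cV[C]_m) : rdot x y = rdot y x.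
Proof. by rewrite !rdotE; apply: eq_bigr => i _; congr (_ + _); rewrite mulrC. Qed.

Lemma rdotDr m (x y z : 'cV[C]_m) : rdot x (y + z) = rdot x y + rdot x z.
Proof. by rewrite /rdot mulmxDr mxE ReD. Qed.

Lemma rdotNr m (x y : 'cV[C]_m) : rdot x (- y) = - rdot x y.
Proof. by rewrite /rdot mulmxN mxE ReN. Qed.

Lemma rdotBr m (x y z : 'cV[C]_m) : rdot x (y - z) = rdot x y - rdot x z.
Proof. by rewrite rdotDr rdotNr. Qed.

Lemma rdotZr m (a : R) (x y : 'cV[C]_m) : rdot x (a%:C *: y) = a * rdot x y.
Proof.
rewrite /rdot -scalemxAr mxE.
by case: ((adjmx x *m y) 0 0) => u v /=; rewrite mul0r subr0.
Qed.

Lemma rdotZl m (a : R) (x y : 'cV[C]_m) : rdot (a%:C *: x) y = a * rdot x y.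
Proof. by rewrite rdotC rdotZr rdotC. Qed.

Lemma rdot0r m (x : 'cV[C]_m) : rdot x 0 = 0.
Proof. by rewrite /rdot mulmx0 mxE. Qed.

Lemma rdot_adjoint m n (M : 'M[C]_(m, n)) x y :
  rdot x (M *m y) = rdot (adjmx M *m x) y.
Proof. by rewrite /rdot adjmxM adjmxK mulmxA. Qed.

Lemma rdot_adjointC m n (M : 'M[C]_(m, n)) x y :
  rdot (M *m x) y = rdot x (adjmx M *m y).
Proof. by rewrite rdotC rdot_adjoint rdotC. Qed.

Lemma rdot_ge0 m (x : 'cV[C]_m) : 0 <= rdot x x.
Proof.
by rewrite rdotE; apply: sumr_ge0 => i _; rewrite addr_ge0 // -expr2 sqr_ge0.
Qed.

Lemma rdot_gt0 m (x : 'cV[C]_m) : x != 0 -> 0 < rdot x x.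
Proof.
rewrite lt_def rdot_ge0 andbT; apply: contra => /eqP.
rewrite rdotE => /eqP; rewrite psumr_eq0 => [/allP x0|i _]; last first.
  by rewrite addr_ge0 // -expr2 sqr_ge0.
apply/eqP/matrixP => i j; rewrite !mxE ord1.
have := x0 i; rewrite mem_index_enum => /(_ isT) /=.
rewrite paddr_eq0 -?expr2 ?sqr_ge0 // !sqrf_eq0.
by case: (x i 0) => a b /= /andP[/eqP-> /eqP->].
Qed.

Lemma rdot_CauchySchwarz m (x y : 'cV[C]_m) : rdot x y ^+ 2 <= rdot x x * rdot y y.
Proof.
have [->|/rdot_gt0 y0] := eqVneq y 0; first by rewrite !rdot0r mulr0 expr0n.
(* With [a], [b], [c] as set below, the square of [c x - b y] expands to [c (a c - b^2)]. *)
have := rdot_ge0 ((rdot y y)%:C *: x - (rdot x y)%:C *: y).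
rewrite rdotBr !rdotZr [rdot (_ - _) x]rdotC [rdot (_ - _) y]rdotC !rdotBr !rdotZr (rdotC y x).
set a := rdot x x; set b := rdot x y; set c := rdot y y in y0 * => h.
rewrite -subr_ge0 -(pmulr_rge0 _ y0); apply: le_trans h _.
by rewrite le_eqVlt; apply/orP; left; apply/eqP; ring.
Qed.

Lemma sqr_norm2 m (x : 'cV[C]_m) : norm2 x ^+ 2 = rdot x x.
Proof.
rewrite /norm2 sqr_sqrtr ?rdotE; last by apply: sumr_ge0 => i _; rewrite addr_ge0 ?sqr_ge0.
by apply: eq_bigr => i _; rewrite !expr2.
Qed.

Lemma norm2E m (x : 'cV[C]_m) : norm2 x = Num.sqrt (rdot x x).
Proof. by rewrite -sqr_norm2 sqrtr_sqr ger0_norm ?sqrtr_ge0. Qed.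

(** For [y = M^* x], Cauchy-Schwarz gives [|y|^4 = <x, M y>^2 <= |x|^2 c |y|^2]; then [|y|^2]
    cancels. *)
Lemma adjoint_bound m n (M : 'M[C]_(m, n)) (c : R) : 0 <= c ->
  (forall x, rdot (M *m x) (M *m x) <= c * rdot x x) ->
  forall x, rdot (adjmx M *m x) (adjmx M *m x) <= c * rdot x x.
Proof.
move=> c0 Mc x; set y := adjmx M *m x.
have [y0|y0] := eqVneq (rdot y y) 0; first by rewrite y0 mulr_ge0 ?rdot_ge0.
have yy : 0 < rdot y y by rewrite lt_def y0 rdot_ge0.
rewrite -(ler_pM2r yy) -expr2.
have -> : rdot y y = rdot x (M *m y) by rewrite rdot_adjoint.
apply: le_trans (rdot_CauchySchwarz _ _) _.
rewrite mulrAC mulrC ler_wpM2r ?rdot_ge0 //.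
by rewrite [X in _ <= _ * X]rdot_adjoint; apply: Mc.
Qed.

End RealDotProduct.

(** * Functional calculus of Hermitian matrices *)

Lemma conj_diag_mul (F : fieldType) n (P D E : 'M[F]_n) : P \in unitmx ->
  (invmx P *m D *m P) *m (invmx P *m E *m P) = invmx P *m (D *m E) *m P.
Proof. by move=> uP; rewrite !mulmxA mulmxK. Qed.

Section SpectralCalculus.
Context {R : realType}.
Local Notation C := R[i].
Context {n : nat}.
Implicit Types (M : 'M[C]_n) (x : 'cV[C]_n) (f g : R -> R).

Lemma hermsymmxE M : (M \is hermsymmx) = (adjmx M == M).
Proof.
apply/is_hermitianmxP/eqP; rewrite expr0 scale1r => h; exact/esym.
Qed.

Lemma realCM (a b : R) : (a * b)%:C = a%:C * b%:C.
Proof. by apply/eqP; rewrite eq_complex /= !mulr0 mul0r subr0 addr0 !eqxx. Qed.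

Definition spec M i : R := complex.Re (spectral_diag M 0 i).

(** The body copies that of [mxpowR], so that real powers are convertible to an instance of it. *)
Definition mxfun f M : 'M[C]_n :=
  invmx (spectralmx M)
    *m diag_mx (map_mx (fun z : C => (f (complex.Re z))%:C) (spectral_diag M))
    *m spectralmx M.

Lemma eq_mxfun f g M : (forall i, f (spec M i) = g (spec M i)) -> mxfun f M = mxfun g M.
Proof.
move=> fg; rewrite /mxfun; set d := map_mx _ _; set d' := map_mx _ _.
suff -> : d = d' by [].
by apply/matrixP => i j; rewrite !mxE !ord1; congr _%:C; apply: fg.
Qed.

Lemma mxfunM f g M : mxfun f M *m mxfun g M = mxfun (fun t => f t * g t) M.
Proof.
rewrite /mxfun; set d := map_mx _ _; set d' := map_mx _ _; set d'' := map_mx _ _.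
have -> : d'' = \row_j (d 0 j * d' 0 j).
  by apply/matrixP => i j; rewrite !mxE ord1 -realCM.
rewrite -mulmx_diag; move: (spectral_unit M) d d' {d''}; move: (spectralmx M).
move=> P uP d d'; exact: conj_diag_mul.
Qed.

Lemma mxfun_cst1 M : mxfun (fun=> 1) M = 1%:M.
Proof.
rewrite /mxfun; set d := map_mx _ _.
have -> : d = const_mx 1 by apply/matrixP => i j; rewrite !mxE.
by rewrite diag_const_mx mulmx1 mulVmx ?spectral_unit.
Qed.

Lemma mxfun_id M : M \is hermsymmx -> mxfun id M = M.
Proof.
move=> hM; have /orthomx_spectralP {2}-> := hermitian_normalmx hM.
rewrite /mxfun; set d := map_mx _ _.
suff -> : d = spectral_diag M by [].
apply/matrixP => i j; rewrite !mxE.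
by rewrite RRe_real // (mxOverP (hermitian_spectral_diag_real hM)).
Qed.

Lemma mxfun_adj f M : adjmx (mxfun f M) = mxfun f M.
Proof.
rewrite /mxfun invmx_unitary ?spectral_unitarymx // -/(adjmx _).
set d := map_mx _ _; have dE : adjmx (diag_mx d) = diag_mx d.
  rewrite /adjmx tr_diag_mx map_diag_mx; apply: congr1.
  by apply/matrixP => i j; rewrite !mxE [LHS]conjc_real.
by rewrite !adjmxM adjmxK dE mulmxA.
Qed.

(** For Hermitian [M], the squared modulus of the [i]-th coordinate of [x] in an orthonormal
    eigenbasis of [M]. *)
Definition spec_weight M x i : R :=
  complex.Re ((spectralmx M *m x) i 0) ^+ 2 + complex.Im ((spectralmx M *m x) i 0) ^+ 2.

Lemma spec_weight_ge0 M x i : 0 <= spec_weight M x i.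
Proof. by rewrite addr_ge0 ?sqr_ge0. Qed.

Lemma rdot_mxfun f M x :
  rdot x (mxfun f M *m x) = \sum_i f (spec M i) * spec_weight M x i.
Proof.
rewrite /mxfun invmx_unitary ?spectral_unitarymx // -/(adjmx _) -!mulmxA -rdot_adjointC rdotE.
apply: eq_bigr => i _; rewrite mul_diag_mx !mxE /spec_weight /spec mxE.
set z := \sum_j _; case: z => a b; set c := f _.
have -> : c%:C * (a +i* b) = (c * a) +i* (c * b).
  by apply/eqP; rewrite eq_complex /= !mul0r subr0 addr0 !eqxx.
rewrite /=; ring.
Qed.

Lemma sum_spec_weight M x : \sum_i spec_weight M x i = rdot x x.
Proof.
have := rdot_mxfun (fun=> 1) M x; rewrite mxfun_cst1 mul1mx => ->.
by apply: eq_bigr => i _; rewrite mul1r.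
Qed.

Lemma rdot_spec M x : M \is hermsymmx ->
  rdot x (M *m x) = \sum_i spec M i * spec_weight M x i.
Proof. by move=> hM; rewrite -{1}(mxfun_id hM) rdot_mxfun. Qed.

Lemma spec_eigenvector M i : M \is hermsymmx ->
  exists2 v : 'cV[C]_n, v != 0 & M *m v = (spec M i)%:C *: v.
Proof.
move=> hM; exists (invmx (spectralmx M) *m delta_mx i 0).
  apply/eqP => /(congr1 (mulmx (spectralmx M))).
  rewrite mulKVmx ?spectral_unit // mulmx0 => /matrixP/(_ i 0).
  by rewrite !mxE !eqxx => /eqP; rewrite oner_eq0.
rewrite -{1}(mxfun_id hM) /mxfun -!mulmxA mulKVmx ?spectral_unit //.
rewrite scalemxAr; congr (_ *m _).
rewrite mul_diag_mx; apply/matrixP => j k; rewrite !mxE /=.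
by case: eqP => [->|]; rewrite ?mulr0 //= /spec.
Qed.

(* [eigenvalue] is about row vectors, hence the adjoint. *)
Lemma eigenvalueP_adj M (a : R) : eigenvalue M a%:C <->
  exists2 v : 'cV[C]_n, v != 0 & adjmx M *m v = a%:C *: v.
Proof.
have adjZ k m (N : 'M[C]_(k, m)) : adjmx (a%:C *: N) = a%:C *: adjmx N.
  by apply/matrixP => i j; rewrite !mxE rmorphM; congr (_ * _); rewrite [LHS]conjc_real.
have adj_neq0 k m (N : 'M[C]_(k, m)) : N != 0 -> adjmx N != 0.
  by apply: contra => /eqP N0; rewrite -(adjmxK N) N0 adjmx0.
split=> [/eigenvalueP[u uM u0]|[v v0 Mv]].
  by exists (adjmx u); rewrite ?adj_neq0 // -adjmxM uM adjZ.
apply/eigenvalueP; exists (adjmx v); rewrite ?adj_neq0 //.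
by rewrite -{1}(adjmxK M) -adjmxM Mv adjZ.
Qed.

Lemma spec_eigenvalue M i : M \is hermsymmx -> eigenvalue M (spec M i)%:C.
Proof.
move=> hM; apply/eigenvalueP_adj; have [v v0 Mv] := spec_eigenvector i hM.
by exists v; rewrite // (eqP (_ : adjmx M == M)) // -hermsymmxE.
Qed.

Lemma rdot_le_spec M c : M \is hermsymmx -> (forall i, spec M i <= c) ->
  forall x, rdot x (M *m x) <= c * rdot x x.
Proof.
move=> hM Mc x; rewrite (rdot_spec _ hM) -(sum_spec_weight M) mulr_sumr.
by apply: ler_sum => i _; rewrite ler_wpM2r ?spec_weight_ge0.
Qed.

Lemma rdot_ge_spec M c : M \is hermsymmx -> (forall i, c <= spec M i) ->
  forall x, c * rdot x x <= rdot x (M *m x).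
Proof.
move=> hM Mc x; rewrite (rdot_spec _ hM) -(sum_spec_weight M) mulr_sumr.
by apply: ler_sum => i _; rewrite ler_wpM2r ?spec_weight_ge0.
Qed.

Lemma posdef_rdot_gt0 M x : posdefmx M -> x != 0 -> 0 < rdot x (M *m x).
Proof.
case=> _ h /h; rewrite /rdot mulmxA ltcE /=; by case/andP.
Qed.

Lemma posdef_spec_gt0 M i : posdefmx M -> 0 < spec M i.
Proof.
move=> pM; have [v v0 Mv] := spec_eigenvector i pM.1.
have := posdef_rdot_gt0 pM v0; rewrite Mv rdotZr.
by rewrite pmulr_lgt0 // rdot_gt0.
Qed.

End SpectralCalculus.

(** * Real powers of positive numbers *)

Section RealPowers.
Context {R : realType}.
Implicit Types (E : R -> Prop) (p q r t x : R).

Lemma exists_expr_lt (z e : R) : 0 <= z < 1 -> 0 < e -> exists k, z ^+ k < e.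
Proof.
move=> /andP[z0 z1] e0.
have c : (z ^+ k @[k --> \oo] --> (0 : R))%classic.
  by apply: cvg_expr; rewrite ger0_norm.
have /(_ _ e e0) [k _ hk] := cvgr_lt (0 : R) c.
by exists k; apply: hk => /=.
Qed.

(** Bisection: intervals around [p] keep both ends in [E] while their length halves. This reduces
    Loewner-Heinz to a statement about midpoints of exponents. *)
Lemma midpoint_closed_dense E : E 0 -> E 1 ->
  (forall p q, E p -> E q -> E ((p + q) / 2)) ->
  forall p (e : R), 0 <= p <= 1 -> 0 < e -> exists2 q, E q & `|q - p| < e.
Proof.
move=> E0 E1 Em p e /andP[p0 p1] e0.
have bisect k : exists a b, [/\ E a, E b, a <= p, p <= b & b - a = 2^-1 ^+ k].
  elim: k => [|k [a [b [Ea Eb ap pb ab]]]].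
    by exists 0, 1; split=> //; rewrite subr0 expr0.
  have Ec := Em _ _ Ea Eb; have [cp|pc] := leP ((a + b) / 2) p.
    by exists ((a + b) / 2), b; split=> //; rewrite exprS -ab; field.
  by exists a, ((a + b) / 2); split=> //; rewrite ?ltW // exprS -ab; field.
have [k ke] : exists k, (2^-1 : R) ^+ k < e by apply: exists_expr_lt => //; lra.
have [a [b [Ea _ ap pb ab]]] := bisect k.
by exists a => //; rewrite distrC ger0_norm ?subr_ge0 //; lra.
Qed.

Lemma powR_continuous_exponent t : 0 < t -> continuous (fun r => t `^ r).
Proof.
move=> t0 r; have -> : (fun r => t `^ r) = (fun r => expR (r * ln t)).
  by apply/funext => s; rewrite /powR gt_eqF.
apply: continuous_comp; first exact: mulrr_continuous.
exact: continuous_expR.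
Qed.

Lemma cvg_sum_powR (I : finType) (d w : I -> R) p : (forall i, 0 < d i) ->
  ((\sum_i d i `^ r * w i) @[r --> p] --> \sum_i d i `^ p * w i)%classic.
Proof.
move=> d0; apply: cvg_big => [|i _]; first exact: add_continuous.
by apply: cvgMr_tmp; apply: powR_continuous_exponent.
Qed.

(** Divided by [t^p], the right-hand side is the convex combination [p t^(1-p) + (1-p) t^(-p)]. The
    bounds [1 + y <= exp y] for its two terms add up to exactly 1. *)
Lemma powR_Bernoulli t p : 0 < t -> 0 <= p <= 1 -> t `^ p <= 1 + p * (t - 1).
Proof.
move=> t0 /andP[p0 p1]; have e1 := expR_ge1Dx (- (p * ln t)).
have e2 := expR_ge1Dx ((1 - p) * ln t).
have -> : t `^ p = expR (p * ln t) by rewrite /powR gt_eqF.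
have h : 1 <= expR (- (p * ln t)) * (1 + p * (t - 1)).
  have -> : expR (- (p * ln t)) * (1 + p * (t - 1))
      = p * expR ((1 - p) * ln t) + (1 - p) * expR (- (p * ln t)).
    rewrite mulrBl mul1r expRD lnK ?posrE //; ring.
  apply: le_trans (lerD (ler_wpM2l p0 e2) (ler_wpM2l _ e1)); last by rewrite subr_ge0.
  by rewrite le_eqVlt; apply/orP; left; apply/eqP; ring.
rewrite -[leLHS]mulr1; apply: le_trans (ler_wpM2l (expR_ge0 _) h) _.
by rewrite mulrA -expRD subrr expR0 mul1r.
Qed.

End RealPowers.

(* Sealed, because comparing two powers by unfolding them is very slow. *)
HB.lock Definition mxpow {R : realType} {n : nat} (M : 'M[R[i]]_n) (a : R) := mxpowR M a.

(** * The Loewner-Heinz inequality *)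

Section LoewnerHeinz.
Context {R : realType} {n : nat}.
Local Notation C := R[i].
Implicit Types (A B M : 'M[C]_n) (x y : 'cV[C]_n) (p q t : R).

Lemma mxpowE M a : mxpow M a = mxfun (fun t => t `^ a) M.
Proof. by rewrite mxpow.unlock. Qed.

Lemma mxpow0 M : mxpow M 0 = 1%:M.
Proof. by rewrite mxpowE -(mxfun_cst1 M); apply: eq_mxfun => i; rewrite powRr0. Qed.

Lemma mxpow1 M : posdefmx M -> mxpow M 1 = M.
Proof.
move=> pM; rewrite mxpowE -{2}(mxfun_id pM.1); apply: eq_mxfun => i.
by rewrite powRr1 // ltW // posdef_spec_gt0.
Qed.

Lemma mxpowD M p q : posdefmx M -> mxpow M p *m mxpow M q = mxpow M (p + q).
Proof.
move=> pM; rewrite !mxpowE mxfunM; apply: eq_mxfun => i.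
by rewrite powRD //; apply/implyP => _; rewrite gt_eqF ?posdef_spec_gt0.
Qed.

Lemma mxpow_adj M p : adjmx (mxpow M p) = mxpow M p.
Proof. by rewrite mxpowE mxfun_adj. Qed.

Lemma mul_mxpowD k M p q (N : 'M[C]_(n, k)) : posdefmx M ->
  mxpow M p *m (mxpow M q *m N) = mxpow M (p + q) *m N.
Proof. by move=> pM; rewrite (mulmxA (mxpow M p)) mxpowD. Qed.

Lemma mxpowK M p x : posdefmx M -> mxpow M p *m (mxpow M (- p) *m x) = x.
Proof. by move=> pM; rewrite mul_mxpowD // subrr mxpow0 mul1mx. Qed.

Lemma rdot_mxpow_half M p x : posdefmx M ->
  rdot x (mxpow M p *m x) = rdot (mxpow M (p / 2) *m x) (mxpow M (p / 2) *m x).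
Proof.
by move=> pM; rewrite [RHS]rdot_adjointC mxpow_adj mul_mxpowD // -splitr.
Qed.

Lemma rdot_mxpow_ge0 M p x : posdefmx M -> 0 <= rdot x (mxpow M p *m x).
Proof. by move=> pM; rewrite rdot_mxpow_half // rdot_ge0. Qed.

Section Pair.
Variables (A B : 'M[C]_n) (t : R).
Hypotheses (pA : posdefmx A) (pB : posdefmx B) (t0 : 0 < t).

Let leq_pow q := forall x, rdot x (mxpow A q *m x) <= t `^ q * rdot x (mxpow B q *m x).

Let K q := mxpow A (q / 2) *m mxpow B (- (q / 2)).

Let K_adj q : adjmx (K q) = mxpow B (- (q / 2)) *m mxpow A (q / 2).
Proof. by rewrite adjmxM !mxpow_adj. Qed.

(** The substitution of [B^(-q/2) x] for [x] turns the inequality of forms into a norm bound on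
    [K q], which can be passed to the adjoint. *)
Let leq_powP q :
  leq_pow q <-> forall x, rdot (K q *m x) (K q *m x) <= t `^ q * rdot x x.
Proof.
split=> h x; last first.
  have := h (mxpow B (q / 2) *m x); rewrite -(mulmxA (mxpow A _)) mul_mxpowD // addNr mxpow0 mul1mx.
  by rewrite -!rdot_mxpow_half.
have := h (mxpow B (- (q / 2)) *m x); rewrite !rdot_mxpow_half //.
by rewrite mxpowK // (mulmxA (mxpow A _)).
Qed.

(* Pedersen's argument: with [w = B^((q-p)/4) v], an eigenvector [v] of
   [(K r)^* (K r)] becomes an eigenvector of [(K p)^* (K q)] for the same
   eigenvalue. *)
Let leq_pow_mid p q : leq_pow p -> leq_pow q -> leq_pow ((p + q) / 2).
Proof.
move=> /leq_powP hp /leq_powP hq; set r := (p + q) / 2; apply/leq_powP.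
pose H := adjmx (K r) *m K r.
have hH : H \is hermsymmx by rewrite hermsymmxE adjmxM adjmxK.
suff sH i : spec H i <= t `^ r.
  by move=> x; rewrite rdot_adjointC (mulmxA (adjmx _)); apply: rdot_le_spec.
have [v v0 Hv] := spec_eigenvector i hH; set l := spec H i in Hv *.
set e := (q - p) / 4; set w := mxpow B e *m v.
have w0 : w != 0.
  apply: contra v0 => /eqP w0; rewrite -(mxpowK (- e) v pB) opprK.
  by rewrite -/w w0 mulmx0.
have Tw : adjmx (K p) *m (K q *m w) = l%:C *: w.
  rewrite /w scalemxAr -Hv /H !K_adj /K -!mulmxA !mul_mxpowD //.
  have -> : - (q / 2) + e = - (r / 2) by rewrite /e /r; field.
  have -> : e + - (r / 2) = - (p / 2) by rewrite /e /r; field.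
  by have -> : p / 2 + q / 2 = r / 2 + r / 2 by rewrite /r; field.
have tr0 : 0 <= t `^ r by apply: powR_ge0.
(* Applying the bounds for [K q] and for the adjoint of [K p] in turn gives [l^2 <= t^p t^q], which
   is [(t^r)^2]. *)
have := adjoint_bound (powR_ge0 _ _) hp (K q *m w); rewrite Tw rdotZl rdotZr.
move=> /le_trans/(_ (ler_wpM2l (powR_ge0 _ _) (hq w))).
rewrite !mulrA ler_pM2r ?rdot_gt0 //.
have -> : t `^ p * t `^ q = t `^ r * t `^ r.
  by rewrite -!powRD ?(gt_eqF t0) ?implybT //; congr (_ `^ _); rewrite /r; field.
move=> h; rewrite leNgt; apply/negP => lt.
by have := ltr_pM tr0 tr0 lt lt; rewrite ltNge h.
Qed.

(** The exponents for which the inequality holds contain 0 and 1 and are closed under midpoints,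
    hence dense in [[0, 1]]. A strict failure at [p] would persist nearby, by continuity in the
    exponent. *)
Lemma Loewner_Heinz p : 0 <= p <= 1 ->
  (forall x, rdot x (A *m x) <= t * rdot x (B *m x)) ->
  forall x, rdot x (mxpow A p *m x) <= t `^ p * rdot x (mxpow B p *m x).
Proof.
move=> p01 AB x; rewrite leNgt; apply/negP => lt.
have E0 : leq_pow 0 by move=> y; rewrite powRr0 !mxpow0 mul1r.
have E1 : leq_pow 1 by move=> y; rewrite powRr1 ?(ltW t0) // !mxpow1.
have cvgP M : posdefmx M ->
  ((rdot x (mxpow M q *m x)) @[q --> p] --> rdot x (mxpow M p *m x))%classic.
  move=> pM; under eq_fun do rewrite mxpowE rdot_mxfun.
  by rewrite mxpowE rdot_mxfun; apply: cvg_sum_powR => i; apply: posdef_spec_gt0.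
have c : ((rdot x (mxpow A q *m x) - t `^ q * rdot x (mxpow B q *m x)) @[q --> p]
   --> rdot x (mxpow A p *m x) - t `^ p * rdot x (mxpow B p *m x))%classic.
  apply: cvgB; first exact: cvgP.
  by apply: cvgM; [apply: powR_continuous_exponent|apply: cvgP].
rewrite -subr_gt0 in lt.
have [e e0 he] := (nbhs_ballP _ _).1 (cvgr_gt _ c _ lt).
have [q Eq qp] := midpoint_closed_dense E0 E1 leq_pow_mid p01 e0.
have := he q; rewrite /ball /= distrC subr_gt0 => /(_ qp).
by rewrite ltNge Eq.
Qed.

(** The adjoint of [K p] is [B^(-p/2) A^(p/2)] and obeys the same bound; it is applied to
    [A^(-p/2) x]. *)
Lemma Loewner_Heinz_inv p : 0 <= p <= 1 ->
  (forall x, rdot x (A *m x) <= t * rdot x (B *m x)) ->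
  forall x, rdot x (mxpow B (- p) *m x) <= t `^ p * rdot x (mxpow A (- p) *m x).
Proof.
move=> p01 AB x; have /leq_powP Kp : leq_pow p by apply: Loewner_Heinz.
have := adjoint_bound (powR_ge0 _ _) Kp (mxpow A (- (p / 2)) *m x).
by rewrite K_adj -(mulmxA (mxpow B _)) mxpowK // !rdot_mxpow_half // !mulNr.
Qed.

End Pair.
End LoewnerHeinz.

(** * Spectral norm, smallest eigenvalue and quadratic forms *)

Section SpectralNorm.
Context {R : realType}.
Local Notation C := R[i].

(** The supremum is meaningful only for a bounded set. The sum of the moduli of the eigenvalues of
    [M^* M] is a crude bound for the squares. *)
Lemma specnorm_set_bounded m n (M : 'M[C]_(m, n)) :
  has_ubound [set norm2 (M *m x) | x in [set x : 'cV[C]_n | norm2 x = 1]]%classic.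
Proof.
pose G := adjmx M *m M.
have hG : G \is hermsymmx by rewrite hermsymmxE adjmxM adjmxK.
exists (Num.sqrt (\sum_i `|spec G i|)) => _ [x /= x1 <-].
rewrite norm2E; apply: ler_wsqrtr; rewrite rdot_adjointC (mulmxA (adjmx M)).
have -> : \sum_i `|spec G i| = (\sum_i `|spec G i|) * rdot x x.
  by rewrite -sqr_norm2 x1 expr1n mulr1.
apply: rdot_le_spec => // i; rewrite (bigD1 i) //=.
apply: le_trans (ler_norm _) _; rewrite lerDl; exact: sumr_ge0.
Qed.

Lemma exists_unit_vector n : (0 < n)%N -> exists x : 'cV[C]_n, norm2 x = 1.
Proof.
case: n => // n _; exists (delta_mx 0 0).
rewrite norm2E rdotE (bigD1 0) //= big1 => [|i i0].
  by rewrite !mxE !eqxx /= mulr1 mulr0 !addr0 sqrtr1.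
by rewrite !mxE (negbTE i0) /= !mulr0 addr0.
Qed.

Lemma specnorm_ge0 m n (M : 'M[C]_(m, n)) : (0 < n)%N -> 0 <= specnorm M.
Proof.
move=> /exists_unit_vector[x x1]; apply: (@le_trans _ _ (norm2 (M *m x))).
  exact: sqrtr_ge0.
by apply: ub_le_sup; [exact: specnorm_set_bounded|exists x].
Qed.

(** By homogeneity, it suffices to test the supremum at [x / |x|]. *)
Lemma rdot_specnorm m n (M : 'M[C]_(m, n)) x :
  rdot (M *m x) (M *m x) <= specnorm M ^+ 2 * rdot x x.
Proof.
have [->|/rdot_gt0 x0] := eqVneq x 0; first by rewrite mulmx0 !rdot0r mulr0.
have s0 : 0 < norm2 x by rewrite norm2E sqrtr_gt0.
set a := (norm2 x)^-1; have a0 : 0 < a by rewrite invr_gt0.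
have : norm2 (M *m (a%:C *: x)) <= specnorm M.
  apply: ub_le_sup; first exact: specnorm_set_bounded.
  exists (a%:C *: x) => //=; rewrite norm2E rdotZl rdotZr -sqr_norm2.
  by rewrite mulrA -expr2 -exprMn mulVf ?gt_eqF // expr1n sqrtr1.
rewrite -scalemxAr => h.
have : norm2 (a%:C *: (M *m x)) ^+ 2 <= specnorm M ^+ 2.
  by apply: lerXn2r => //; rewrite ?nnegrE ?sqrtr_ge0 //; apply: le_trans h; apply: sqrtr_ge0.
rewrite sqr_norm2 rdotZl rdotZr mulrA -expr2 => h2.
have := ler_wpM2r (ltW x0) h2; rewrite mulrAC -(sqr_norm2 x) -exprMn mulVf ?gt_eqF //.
by rewrite expr1n mul1r.
Qed.

Lemma specnorm_le m n (M : 'M[C]_(m, n)) c : (0 < n)%N -> 0 <= c ->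
  (forall x, rdot (M *m x) (M *m x) <= c ^+ 2 * rdot x x) -> specnorm M <= c.
Proof.
move=> /exists_unit_vector[x0 x01] c0 Mc; apply: ge_sup.
  by exists (norm2 (M *m x0)), x0.
move=> _ [x /= x1 <-]; rewrite norm2E -(ger0_norm c0) -sqrtr_sqr.
by apply: ler_wsqrtr; have := Mc x; rewrite -(sqr_norm2 x) x1 expr1n mulr1.
Qed.

Lemma normr_rdot_specnorm n (M : 'M[C]_n) x : (0 < n)%N ->
  `|rdot x (M *m x)| <= specnorm M * rdot x x.
Proof.
move=> n0; rewrite -(ler_pXn2r (n := 2)) ?nnegrE ?mulr_ge0 ?specnorm_ge0 ?rdot_ge0 //.
rewrite real_normK ?num_real //; apply: le_trans (rdot_CauchySchwarz _ _) _.
rewrite mulrC exprMn [rdot x x ^+ 2]expr2 mulrA ler_wpM2r ?rdot_ge0 //.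
exact: rdot_specnorm.
Qed.

(** Testing the form on eigenvectors bounds every eigenvalue by [c] in modulus, and [|M x|^2] is the
    sum of the squared eigenvalues with the weights of [x]. This converts the final estimate on
    forms into one on norms. *)
Lemma herm_specnorm_le n (M : 'M[C]_n) c : (0 < n)%N -> M \is hermsymmx ->
  (forall x, `|rdot x (M *m x)| <= c * rdot x x) -> specnorm M <= c.
Proof.
move=> n0 hM Mc.
have Sc i : `|spec M i| <= c.
  have [v /rdot_gt0 v0 Mv] := spec_eigenvector i hM.
  have := Mc v; rewrite Mv rdotZr normrM (gtr0_norm v0).
  by rewrite ler_pM2r.
have c0 : 0 <= c by apply: le_trans (Sc (Ordinal n0)).
apply: specnorm_le => // x.
have aM : adjmx M = M by apply/eqP; rewrite -hermsymmxE.
rewrite rdot_adjointC aM -{1}(mxfun_id hM) -{2}(mxfun_id hM) (mulmxA (mxfun _ _)).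
rewrite mxfunM rdot_mxfun -(sum_spec_weight M) mulr_sumr.
apply: ler_sum => i _; rewrite ler_wpM2r ?spec_weight_ge0 //= -expr2.
by rewrite -real_normK ?num_real // lerXn2r ?nnegrE.
Qed.

Lemma posdef_unitmx n (M : 'M[C]_n) : posdefmx M -> M \in unitmx.
Proof.
move=> pM; suff /mulmx1_unit[] : M *m mxpow M (-1) = 1%:M by [].
by rewrite -{1}(mxpow1 pM) mxpowD // subrr mxpow0.
Qed.

Lemma posdef_eigenvalue_gt0 n (M : 'M[C]_n) a : posdefmx M ->
  eigenvalue M a%:C -> 0 < a.
Proof.
move=> pM /eigenvalueP_adj[v v0].
rewrite (eqP (_ : adjmx M == M)) -?hermsymmxE ?pM.1 // => Mv.
by have := posdef_rdot_gt0 pM v0; rewrite Mv rdotZr pmulr_lgt0 // rdot_gt0.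
Qed.

Lemma lambda_min_le n (M : 'M[C]_n) x : posdefmx M ->
  lambda_min M * rdot x x <= rdot x (M *m x).
Proof.
move=> pM; apply: rdot_ge_spec => [|i]; first exact: pM.1.
apply: ge_inf; last exact: spec_eigenvalue pM.1.
by exists 0 => a /= /(posdef_eigenvalue_gt0 pM)/ltW.
Qed.

(** An eigenvector of [M] for [a] is scaled by [1/a] under the inverse, so [1 <= nu * a]; this
    passes to the infimum over [a]. *)
Lemma lambda_min_specnorm_invmx n (M : 'M[C]_n) : (0 < n)%N -> posdefmx M ->
  1 <= specnorm (invmx M) * lambda_min M.
Proof.
move=> n0 pM; set nu := specnorm _.
have nuP a : eigenvalue M a%:C -> 1 <= nu * a.
  move=> ea; have a0 := posdef_eigenvalue_gt0 pM ea.
  move: ea => /eigenvalueP_adj[v v0].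
  rewrite (eqP (_ : adjmx M == M)) -?hermsymmxE ?pM.1 // => Mv.
  have vE : v = a%:C *: (invmx M *m v).
    by rewrite scalemxAr -Mv mulKmx // posdef_unitmx.
  have := rdot_specnorm (invmx M) v; rewrite -/nu => h.
  have := ler_wpM2l (sqr_ge0 a) h.
  have -> : a ^+ 2 * rdot (invmx M *m v) (invmx M *m v) = rdot v v.
    by rewrite [in RHS]vE rdotZl rdotZr mulrA.
  rewrite mulrA -exprMn -{1}[rdot v v]mul1r ler_pM2r ?rdot_gt0 // [nu * a]mulrC.
  have anu0 : 0 <= a * nu by rewrite mulr_ge0 ?(ltW a0) ?specnorm_ge0.
  by rewrite expr_ge1.
have e0 := spec_eigenvalue (Ordinal n0) pM.1.
have nu0 : 0 < nu.
  have := nuP _ e0; have := posdef_eigenvalue_gt0 pM e0.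
  by move=> a0 /(lt_le_trans ltr01); rewrite pmulr_lgt0.
rewrite -ler_pdivrMl // mulr1; apply: lb_le_inf; first by exists (spec M (Ordinal n0)).
by move=> a /= /nuP; rewrite -[_^-1]mulr1 ler_pdivrMl.
Qed.

(** Positivity in [R[i]] also asks for a zero imaginary part. It is automatic here, since the form
    of a Hermitian matrix equals its own conjugate. *)
Lemma posdefmxP n (M : 'M[C]_n) : posdefmx M <->
  M \is hermsymmx /\ forall x, x != 0 -> 0 < rdot x (M *m x).
Proof.
split=> [pM|[hM M0]].
  by split=> [|x x0]; [exact: pM.1|apply: posdef_rdot_gt0].
split=> // x x0; rewrite ltcE; apply/andP; split; last first.
  by have := M0 x x0; rewrite /rdot (mulmxA (adjmx x)).
set z := fun_of_matrix _ _ _; suff : Num.conj z = z.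
  by case: z => a b [] /eqP; rewrite eq_sym -addr_eq0 -mulr2n mulrn_eq0 /= eq_sym.
have : adjmx (adjmx x *m M *m x) = adjmx x *m M *m x.
  rewrite !adjmxM adjmxK (eqP (_ : adjmx M == M)) -?hermsymmxE //.
  by rewrite (mulmxA (adjmx x)).
by rewrite /z; move: (adjmx x *m M *m x) => N /matrixP/(_ 0 0); rewrite !mxE.
Qed.

End SpectralNorm.

(** * The fixed point map: contraction and invariant ball *)

Section FixedPointMap.
Context {R : realType} {n : nat}.
Local Notation C := R[i].
Variables (A Q : 'M[C]_n) (p : R).
Hypotheses (n_gt0 : (0 < n)%N) (p_ge0 : 0 <= p) (p_le1 : p <= 1) (pQ : posdefmx Q).
Implicit Types (X Y Z : 'M[C]_n) (x z : 'cV[C]_n) (t u : R).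

Definition fixmap Y : 'M[C]_n := Q + adjmx A *m (mxpow Y (- p) *m A).

Lemma rdot_fixmap Y x : rdot x (fixmap Y *m x)
  = rdot x (Q *m x) + rdot (A *m x) (mxpow Y (- p) *m (A *m x)).
Proof.
rewrite /fixmap (mulmxDl Q) rdotDr; congr (_ + _).
by rewrite -(mulmxA (adjmx A)) -(mulmxA (mxpow Y _)) [RHS]rdot_adjointC.
Qed.

Lemma fixmap_posdef Y : posdefmx Y -> posdefmx (fixmap Y).
Proof.
move=> pY; apply/posdefmxP; split=> [|x x0].
  rewrite hermsymmxE /fixmap; apply/eqP.
  have adjD (M N : 'M[C]_n) : adjmx (M + N) = adjmx M + adjmx N.
    by apply/matrixP => i j; rewrite !mxE rmorphD.
  rewrite adjD !adjmxM adjmxK mxpow_adj (mulmxA (adjmx A)); congr (_ + _).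
  by apply/eqP; rewrite -hermsymmxE pQ.1.
rewrite rdot_fixmap; apply: ltr_wpDr; first exact: rdot_mxpow_ge0.
exact: posdef_rdot_gt0.
Qed.

(** Loewner-Heinz yields the factor [t^p]; Bernoulli's inequality makes it affine in [t]. *)
Lemma rdot_mxpowN_le X Y t z : posdefmx X -> posdefmx Y -> 1 <= t ->
  (forall x, rdot x (X *m x) <= t * rdot x (Y *m x)) ->
  rdot z (mxpow Y (- p) *m z) <= (1 + p * (t - 1)) * rdot z (mxpow X (- p) *m z).
Proof.
move=> pX pY t1 XY; have t0 : 0 < t by apply: lt_le_trans t1.
have p01 : 0 <= p <= 1 by rewrite p_ge0.
apply: le_trans (Loewner_Heinz_inv pX pY t0 p01 XY z) _.
by rewrite ler_wpM2r ?rdot_mxpow_ge0 ?powR_Bernoulli.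
Qed.

(* [fixmap] contracts Thompson's metric by the factor [p]; stated for one of the
   two inequalities between [X] and [Y]. *)
Lemma fixmap_contraction X Y u x : posdefmx X -> posdefmx Y -> 0 <= u ->
  (forall x, rdot x (X *m x) <= (1 + u) * rdot x (Y *m x)) ->
  rdot x (fixmap Y *m x) <= (1 + p * u) * rdot x (fixmap X *m x).
Proof.
move=> pX pY u0 XY.
have leE (a b q s s' k : R) : a = q + s -> b = q + s' -> q <= k * q -> s <= k * s' ->
    a <= k * b.
  by move=> -> -> qk sk; rewrite mulrDr lerD.
apply: (leE _ _ _ _ _ _ (rdot_fixmap Y x) (rdot_fixmap X x)); last first.
  have u1 : 1 <= 1 + u by rewrite lerDl.
  have := rdot_mxpowN_le (A *m x) pX pY u1 XY.
  by rewrite [1 + u]addrC addrK.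
rewrite ler_peMl ?lerDl ?mulr_ge0 //.
have [->|x0] := eqVneq x 0; first by rewrite mulmx0 rdot0r.
by rewrite ltW ?posdef_rdot_gt0.
Qed.

Lemma posdef_rdot_ge0 X x : posdefmx X -> 0 <= rdot x (X *m x).
Proof.
have [->|x0 pX] := eqVneq x 0; first by rewrite mulmx0 rdot0r.
by rewrite ltW ?posdef_rdot_gt0.
Qed.

Lemma lambda_min_gt0 X : posdefmx X -> 0 < lambda_min X.
Proof.
move=> pX; have := lambda_min_specnorm_invmx n_gt0 pX.
move=> /(lt_le_trans ltr01) h; rewrite -(pmulr_rgt0 _ (x := specnorm (invmx X))) //.
rewrite lt_def specnorm_ge0 // andbT; apply: contraTneq h => ->.
by rewrite mul0r ltxx.
Qed.

(** Two positive definite matrices are at finite Thompson distance, which starts the iteration. The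
    form of [X] is at most [|X| |x|^2], and [|x|^2] is at most the form of [Y] divided by
    [lambda_min Y]. *)
Lemma posdef_dominated X Y : posdefmx X -> posdefmx Y ->
  exists2 u, 0 <= u & forall x, rdot x (X *m x) <= (1 + u) * rdot x (Y *m x).
Proof.
move=> pX pY; have l0 := lambda_min_gt0 pY.
exists (specnorm X / lambda_min Y) => [|x]; first by rewrite divr_ge0 ?specnorm_ge0 ?ltW.
rewrite mulrDl mul1r; apply: le_trans (_ : _ <= specnorm X / lambda_min Y * rdot x (Y *m x)) _.
  apply: le_trans (ler_norm _) (le_trans (normr_rdot_specnorm X x n_gt0) _).
  rewrite -mulrA ler_wpM2l ?specnorm_ge0 // ler_pdivlMl //.
  exact: lambda_min_le.
by rewrite lerDr posdef_rdot_ge0.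
Qed.

(** With [s = d / l], the hypothesis gives [(1 - s) X <= Y <= (1 + s) X], and [1 / (1 - s) = 1 + s']
    for [s' = d / (l - d)]. Both comparisons pass to the powers, where [p <= 1] absorbs the factor
    [p]. *)
Lemma mxpowN_perturbation X Y d z : posdefmx X -> posdefmx Y ->
  0 <= d < lambda_min X ->
  (forall x, `|rdot x (Y *m x) - rdot x (X *m x)| <= d * rdot x x) ->
  `|rdot z (mxpow Y (- p) *m z) - rdot z (mxpow X (- p) *m z)|
    <= d / (lambda_min X - d) * rdot z (mxpow X (- p) *m z).
Proof.
move=> pX pY /andP[d0 dl] XYd; set l := lambda_min X in dl *.
have l0 : 0 < l by apply: lambda_min_gt0.
have ld : 0 < l - d by rewrite subr_gt0.
have XYd' x : `|rdot x (Y *m x) - rdot x (X *m x)| <= d / l * rdot x (X *m x).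
  apply: le_trans (XYd x) _; rewrite -mulrA ler_wpM2l // ler_pdivlMl //.
  exact: lambda_min_le.
set s := d / l; set s' := d / (l - d).
have s0 : 0 <= s by rewrite divr_ge0 ?(ltW l0).
have s'0 : 0 <= s' by rewrite divr_ge0 ?(ltW ld).
have ss' : (1 + s') * (1 - s) = 1.
  by rewrite /s /s'; field; rewrite !gt_eqF.
have XY x : rdot x (X *m x) <= (1 + s') * rdot x (Y *m x).
  have := XYd' x; rewrite ler_norml => /andP[h _].
  have h' : (1 - s) * rdot x (X *m x) <= rdot x (Y *m x) by rewrite /s; lra.
  have := ler_wpM2l (addr_ge0 ler01 s'0) h'.
  by rewrite mulrA ss' mul1r.
have YX x : rdot x (Y *m x) <= (1 + s) * rdot x (X *m x).
  by have := XYd' x; rewrite ler_norml -/s => /andP[_ h]; lra.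
have s1 : 1 <= 1 + s by rewrite lerDl.
have s'1 : 1 <= 1 + s' by rewrite lerDl.
have := rdot_mxpowN_le z pX pY s'1 XY; have := rdot_mxpowN_le z pY pX s1 YX.
have := rdot_mxpow_ge0 (- p) z pX; have := rdot_mxpow_ge0 (- p) z pY.
move: (rdot z (mxpow X _ *m z)) (rdot z (mxpow Y _ *m z)) => a b b0 a0 ab ba.
have ab' : a <= (1 + s) * b.
  apply: le_trans ab _; rewrite ler_wpM2r //.
  by have := ler_wpM2r s0 p_le1; lra.
have ba' : b <= (1 + s') * a.
  apply: le_trans ba _; rewrite ler_wpM2r //.
  by have := ler_wpM2r s'0 p_le1; lra.
rewrite ler_norml; apply/andP; split; last by lra.
(* [ab'] bounds [a - b] relative to [b]; if [b <= a], then [a - b <= s b <= s a <= s' a]. *)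
have [ba_le|ab_lt] := leP b a; last by have := mulr_ge0 s'0 a0; lra.
have : s <= s' by have := mulr_ge0 s0 s'0; lra.
move=> /(ler_wpM2r a0) h; have := ler_wpM2l s0 ba_le; lra.
Qed.

(* [X] is the limit of the iterates of [fixmap], which stay in the ball. *)
Lemma fixpoint_in_ball X Xt d : p < 1 -> posdefmx X -> posdefmx Xt -> X = fixmap X ->
  0 <= d ->
  (forall Y, posdefmx Y ->
    (forall x, `|rdot x (Y *m x) - rdot x (Xt *m x)| <= d * rdot x x) ->
    forall x, `|rdot x (fixmap Y *m x) - rdot x (Xt *m x)| <= d * rdot x x) ->
  forall x, `|rdot x (X *m x) - rdot x (Xt *m x)| <= d * rdot x x.
Proof.
move=> p_lt1 pX pXt X_fix d0 ball_stable x.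
(* Besides membership in the ball, this says that the Thompson distance from [Y] to [X] is at most
   [ln (1 + u)]. *)
pose approx u := exists Y, [/\ posdefmx Y,
  forall x, `|rdot x (Y *m x) - rdot x (Xt *m x)| <= d * rdot x x,
  forall x, rdot x (X *m x) <= (1 + u) * rdot x (Y *m x) &
  forall x, rdot x (Y *m x) <= (1 + u) * rdot x (X *m x)].
have approx_step u : 0 <= u -> approx u -> approx (p * u).
  move=> u0 [Y [pY Yball XY YX]]; exists (fixmap Y); split.
  - exact: fixmap_posdef.
  - exact: ball_stable.
  - by move=> y; rewrite {1}X_fix; apply: fixmap_contraction.
  - by move=> y; rewrite {1}X_fix; apply: fixmap_contraction.
have [u u0 au] : exists2 u, 0 <= u & approx u.
  have [v v0 Xv] := posdef_dominated pX pXt; have [w w0 wX] := posdef_dominated pXt pX.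
  exists (v + w); first exact: addr_ge0.
  exists Xt; split=> // y; first by rewrite subrr normr0 mulr_ge0 ?rdot_ge0.
    by apply: le_trans (Xv y) _; rewrite ler_wpM2r ?posdef_rdot_ge0 // lerD2l lerDl.
  by apply: le_trans (wX y) _; rewrite ler_wpM2r ?posdef_rdot_ge0 // lerD2l lerDr.
have aku k : approx (p ^+ k * u).
  elim: k => [|k IH]; first by rewrite expr0 mul1r.
  by rewrite exprS -mulrA; apply: approx_step => //; rewrite mulr_ge0 ?exprn_ge0.
(* [m] dominates the forms at [x] of [X] and of every matrix in the ball, so the forms of [X] and of
   the [k]-th approximant differ by at most [p ^+ k * u * m]. *)
set m := rdot x (X *m x) + rdot x (Xt *m x) + d * rdot x x.
have [X0 Xt0] := (posdef_rdot_ge0 x pX, posdef_rdot_ge0 x pXt).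
have x0 := mulr_ge0 d0 (rdot_ge0 x).
have m0 : 0 <= m by rewrite /m !addr_ge0.
apply/ler_addgt0Pr => e e0.
have um0 : 0 < u * m + 1 by rewrite ltr_wpDl ?mulr_ge0.
have p01 : 0 <= p < 1 by rewrite p_ge0.
have [k] := exists_expr_lt p01 (divr_gt0 e0 um0); rewrite ltr_pdivlMr // => ke.
have [Y [pY Yball XY YX]] := aku k.
have pk0 : 0 <= p ^+ k by rewrite exprn_ge0.
have v0 : 0 <= p ^+ k * u by rewrite mulr_ge0.
have vm : p ^+ k * u * m <= e.
  apply: le_trans (ltW ke); rewrite -mulrA ler_wpM2l //; lra.
move: (XY x) (YX x) (Yball x) v0 vm; rewrite /m.
move: X0 Xt0 x0 (posdef_rdot_ge0 x pY).
move: (rdot x (X *m x)) (rdot x (Xt *m x)) (rdot x (Y *m x)) (d * rdot x x) (p ^+ k * u).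
move=> a b c f v a0 b0 f0 c0 ac ca; rewrite !ler_norml => /andP[cb1 cb2] v0 vm.
have vc : v * c <= v * (b + f) by rewrite ler_wpM2l //; lra.
have va : 0 <= v * a by rewrite mulr_ge0.
have vbf : 0 <= v * (b + f) by rewrite mulr_ge0 ?addr_ge0.
by apply/andP; split; lra.
Qed.

End FixedPointMap.

(* [delta = theta * r] is the smaller root of [delta^2 - theta1 delta + l r = 0]. *)
Lemma quadratic_root_facts {R : realType} (l r c : R) :
  0 < l -> 0 <= r -> c < 1 ->
  let theta1 := (1 - c) * l + r in
  let theta := 2 * l / (theta1 + Num.sqrt (theta1 ^+ 2 - 4 * l * r)) in
  0 <= c -> r <= theta1 / 2 * Num.min 1 (theta1 / (2 * l)) ->
  [/\ 0 < theta1, r <= theta * r, theta * r <= (1 - c) * l &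
      (theta * r) * (l - theta * r) = r * (l - theta * r) + c * l * (theta * r)].
Proof.
move=> l0 r0 c1 theta1 theta c0 hr.
have t0 : 0 < theta1 by rewrite ltr_wpDr // mulr_gt0 ?subr_gt0.
have h1 : 2 * r <= theta1.
  have : r <= theta1 / 2 * 1.
    by apply: le_trans hr _; rewrite ler_wpM2l ?ge_min ?lexx // ltW // divr_gt0.
  lra.
have h2 : 4 * l * r <= theta1 ^+ 2.
  have : r <= theta1 / 2 * (theta1 / (2 * l)).
    by apply: le_trans hr _; rewrite ler_wpM2l ?ge_min ?lexx ?orbT // ltW // divr_gt0.
  have -> : theta1 / 2 * (theta1 / (2 * l)) = theta1 ^+ 2 / (4 * l).
    by field; rewrite gt_eqF.
  by rewrite ler_pdivlMr ?mulr_gt0 // => h; rewrite [leLHS]mulrC.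
set D := theta1 ^+ 2 - 4 * l * r in theta *.
have D0 : 0 <= D by rewrite /D; lra.
have s0 := sqrtr_ge0 D. have sD := sqr_sqrtr D0.
set s := Num.sqrt D in theta s0 sD *.
(* Rationalization: [(theta1 - s) (theta1 + s) = 4 l r]. *)
have E : theta * r = (theta1 - s) / 2.
  have ts0 : 0 < theta1 + s by apply: ltr_wpDr.
  have ts : theta1 + s != 0 by rewrite gt_eqF.
  have -> : theta * r = 2 * l * r / (theta1 + s) by rewrite /theta mulrAC.
  apply: (mulIf ts); rewrite mulfVK //.
  have -> : (theta1 - s) / 2 * (theta1 + s) = (theta1 ^+ 2 - s ^+ 2) / 2 by field.
  by rewrite sD /D; field.
(* This is [r <= theta * r] rewritten through [E]; the squares satisfy
   [(theta1 - 2 r)^2 - D = 4 r c l]. *)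
have s_le : s <= theta1 - 2 * r.
  rewrite -(ler_pXn2r (n := 2)) ?nnegrE ?subr_ge0 // sD /D.
  have : 0 <= r * (c * l) by rewrite !mulr_ge0 ?(ltW l0).
  rewrite /theta1; lra.
split=> //; rewrite E; first lra.
  (* By [h1], [r <= (1 - c) l]. *)
  have : theta1 <= 2 * ((1 - c) * l) by rewrite /theta1 in h1 *; lra.
  lra.
have -> : (theta1 - s) / 2 * (l - (theta1 - s) / 2)
  = (theta1 * s) / 2 + (theta1 - s) / 2 * l - (theta1 ^+ 2 + s ^+ 2) / 4 by field.
by rewrite sD /D /theta1; field.
Qed.

(* From the scalar quadratic and the invariant ball to the error bound *)
Local Close Scope complex_scope.

Theorem theorem7p1 (R : realType) (n : nat) (p : R)
    (A Q X Xt : 'M[R[i]]_n)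
    (n_gt0 : (0 < n)%N) (p_gt0 : 0 < p) (p_lt1 : p < 1)
    (Q_posdef : posdefmx Q)
    (X_posdef : posdefmx X)
    (X_sol : X - A ^t* *m mxpowR X (- p) *m A = Q)
    (Xt_posdef : posdefmx Xt) :
  let res : 'M[R[i]]_n := Q + A ^t* *m mxpowR Xt (- p) *m A - Xt in
  let c : R := specnorm (mxpowR Xt (- (p / 2)) *m A) ^+ 2
                 * specnorm (invmx Xt) in
  let theta1 : R := (1 - c) * lambda_min Xt + specnorm res in
  let theta : R := 2 * lambda_min Xt
    / (theta1 + Num.sqrt (theta1 ^+ 2 - 4 * lambda_min Xt * specnorm res)) in
  c < 1 ->
  specnorm res <= theta1 / 2 * Num.min 1 (theta1 / (2 * lambda_min Xt)) ->
  0 < theta1 /\ specnorm (Xt - X) <= theta * specnorm res.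
Proof.
move=> res c theta1 theta c1 hr.
have resE : res = fixmap A Q p Xt - Xt.
  by rewrite /res /fixmap mxpow.unlock (mulmxA (adjmx A)).
have X_fix : X = fixmap A Q p X.
  rewrite -{1}(subrK (A ^t* *m mxpowR X (- p) *m A) X) X_sol.
  by rewrite /fixmap mxpow.unlock (mulmxA (adjmx A)).
have l0 := lambda_min_gt0 n_gt0 Xt_posdef.
have r0 : 0 <= specnorm res by apply: specnorm_ge0.
have c0 : 0 <= c by rewrite mulr_ge0 ?sqr_ge0 ?specnorm_ge0.
have [t0 rd dl dE] := quadratic_root_facts l0 r0 c1 c0 hr.
rewrite -/theta1 -/theta in t0 rd dl dE *.
split; first exact: t0.
move: dE dl rd; set d := theta * specnorm res; set l := lambda_min Xt in l0 * => dE dl rd.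
have d0 : 0 <= d by apply: le_trans rd.
pose kappa := specnorm (mxpowR Xt (- (p / 2)) *m A) ^+ 2.
have kappa_le : kappa <= c * l.
  rewrite /c -mulrA -{1}[kappa]mulr1 ler_wpM2l ?sqr_ge0 //.
  exact: lambda_min_specnorm_invmx.
clearbody theta theta1 c.
have p0 := ltW p_gt0; have p1 := ltW p_lt1.
have kappaP x : rdot (A *m x) (mxpow Xt (- p) *m (A *m x)) <= kappa * rdot x x.
  rewrite rdot_mxpow_half // mulNr (mulmxA (mxpow _ _)) mxpow.unlock.
  exact: rdot_specnorm.
have resP x : `|rdot x (fixmap A Q p Xt *m x) - rdot x (Xt *m x)| <= specnorm res * rdot x x.
  by rewrite -rdotBr -mulmxBl -resE; apply: normr_rdot_specnorm.
suff ball x : `|rdot x (X *m x) - rdot x (Xt *m x)| <= d * rdot x x.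
  apply: (herm_specnorm_le n_gt0) => [|y].
    rewrite hermsymmxE; apply/eqP.
    have adjB : adjmx (Xt - X) = adjmx Xt - adjmx X.
      by apply/matrixP => i j; rewrite !mxE rmorphB.
    have adjE M : posdefmx M -> adjmx M = M.
      by case=> hM _; apply/eqP; rewrite -hermsymmxE.
    by rewrite adjB !adjE.
  by rewrite (mulmxBl Xt) rdotBr distrC; apply: ball.
(* The perturbation bound divides by [l - d], whereas [dl] and [c0] only give [d <= l]. *)
have [dl_lt|dl_ge] := ltP d l.
  apply: (fixpoint_in_ball n_gt0 p0 p1 Q_posdef p_lt1 X_posdef Xt_posdef X_fix d0).
  move=> Y pY Yball y.
  have dld : 0 < l - d by rewrite subr_gt0.
  have d0l : 0 <= d < l by rewrite d0.
  have pert := mxpowN_perturbation n_gt0 p0 p1 (A *m y) Xt_posdef pY d0l Yball.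
  (* The terms in [Q] cancel, leaving the residual plus the perturbation of the power. *)
  have -> : rdot y (fixmap A Q p Y *m y) - rdot y (Xt *m y)
      = (rdot y (fixmap A Q p Xt *m y) - rdot y (Xt *m y))
        + (rdot (A *m y) (mxpow Y (- p) *m (A *m y))
           - rdot (A *m y) (mxpow Xt (- p) *m (A *m y))).
    have addE (a b q' s t u : R) : a = q' + s -> b = q' + u -> a - t = (b - t) + (s - u).
      by move=> -> ->; ring.
    exact: addE (rdot_fixmap A Q p Y y) (rdot_fixmap A Q p Xt y).
  apply: le_trans (ler_normD _ _) (le_trans (lerD (resP y) pert) _).
  have q0 : 0 <= d / (l - d) by rewrite divr_ge0 // ltW.
  (* After division by [l - d], [dE] says that this sum, with [c * l] in place of [kappa], is
     exactly [d]. *)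
  have h : specnorm res + d / (l - d) * kappa <= d.
    apply: le_trans (lerD (lexx _) (ler_wpM2l q0 kappa_le)) _.
    have -> : specnorm res + d / (l - d) * (c * l) =
        (specnorm res * (l - d) + c * l * d) / (l - d).
      by field; rewrite gt_eqF.
    by rewrite -dE mulfK ?gt_eqF.
  apply: le_trans (lerD (lexx _) (ler_wpM2l q0 (kappaP y))) _.
  have leE (r' s k e N : R) : 0 <= N -> r' + s * k <= e -> r' * N + s * (k * N) <= e * N.
    by move=> N0 rske; rewrite mulrA -mulrDl ler_wpM2r.
  exact: leE (rdot_ge0 y) h.
(* Here [l <= d <= (1 - c) l] forces [c = 0], hence [A = 0]. *)
have cl0 : c * l <= 0 by lra.
have Ax0 : A *m x = 0.
  have := le_trans (kappaP x) (ler_wpM2r (rdot_ge0 x) (le_trans kappa_le cl0)).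
  rewrite mul0r rdot_mxpow_half // leNgt.
  have [w0 _|/rdot_gt0-> //] := eqVneq (mxpow Xt (- p / 2) *m (A *m x)) 0.
  by rewrite -(mxpowK (p / 2) (A *m x) Xt_posdef) -mulNr w0 mulmx0.
(* Since [A x = 0], both forms reduce to that of [Q], so the error at [x] is the residual, bounded
   by [rd]. *)
have resx : rdot x (fixmap A Q p Xt *m x) = rdot x (X *m x).
  have E Y : rdot x (fixmap A Q p Y *m x) = rdot x (Q *m x).
    by apply: etrans (rdot_fixmap A Q p Y x) _; rewrite Ax0 mulmx0 rdot0r addr0.
  by apply: etrans (E Xt) _; rewrite [in RHS]X_fix; apply: esym (E X).
rewrite -resx; apply: le_trans (resP x) _.
by rewrite ler_wpM2r ?rdot_ge0.
Qed.
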